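(* Let $n\ge5$ be an integer such that $\frac4n$ is an irreducible proper fraction. Then $\frac4n$ has a faithful decomposition of the form \[ \frac4n=\frac1x+\frac1y+\frac rz,\qquad r=1\text{ or }r=2, \] with $x,y,z$ pairwise distinct positive integers.
   Context: A (fraction) decomposition of a positive rational $\frac mn$ is an expression $\frac mn=\frac{a_1}{b_1}+\cdots+\frac{a_k}{b_k}$ where $a_1,\dots,a_k$ are positive integers and $b_1,\dots,b_k$ are pairwise distinct positive integers. For a positive irreducible fraction $u=\frac mn$, such a decomposition is called faithful if for all integers $x_1,\dots,x_k$ with $0\le x_i\le a_i$, the number $v=\sum_{i=1}^k \frac{x_i}{b_i}$ does not lie in $\frac1n\mathbb Z$ unless $v=u$ or $v=0$. *)

(* Defs.v *)
From mathcomp Require Import all_boot all_order all_algebra.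

Set Implicit Arguments.
Unset Strict Implicit.
Unset Printing Implicit Defensive.

Import GRing.Theory Num.Theory.
Local Open Scope ring_scope.

Definition frac_sum (k : nat) (x : 'I_k -> nat) (b : k.-tuple nat) : rat :=
  \sum_(i < k) (x i)%:R / (tnth b i)%:R.

Definition decomposition (u : rat) (k : nat) (a b : k.-tuple nat) : Prop :=
  [/\ forall i, (0 < tnth a i)%N,
      forall i, (0 < tnth b i)%N,
      injective (tnth b)
    & u = frac_sum (tnth a) b].

(* v lies in (1/n)Z *)
Definition in_inv_multiples (n : nat) (v : rat) : Prop :=
  exists c : int, v = c%:~R / n%:R.

(* The fraction m/n is meant to be positive and in lowest terms: the condition
   depends on n, not only on the value of m/n. *)
Definition faithful_decomposition (m n k : nat) (a b : k.-tuple nat) : Prop :=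
  decomposition (m%:R / n%:R) a b /\
  forall x : 'I_k -> nat, (forall i, (x i <= tnth a i)%N) ->
    in_inv_multiples n (frac_sum x b) ->
    frac_sum x b = m%:R / n%:R \/ frac_sum x b = 0.

(* Main.v *)
Require Import Defs.
From mathcomp Require Import all_boot all_order all_algebra.
From mathcomp Require Import zify ring.

(** Multiples of [1/n] are stable under [v |-> 4/n - v], so faithfulness of
    [1/x + 1/y + r/z] only has to be checked on [1/x], [1/y], [c/z] and, when
    [r = 2], on [1/x + 1/z].

    If [n = 4q - 1], then [4/n = 1/q + 1/(nq)], and the last term is split by
    [1/t = 1/(t+1) + 1/(t(t+1))].  If [n = 4q + 1], then
    [4/n = 1/(q+1) + 3/m] with [m = n(q+1)], and according to [m] modulo [3],
    - [3/(3t) = 1/(t+1) + 1/(t(t+1))];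
    - [3/(3y-2) = 1/y + 2/((3y-2)y)];
    - [3/(3y-1) = 1/y + 1/((3y-1)y)].
    Only [n = 9] escapes, since [q+1 = 3] divides it: [4/9 = 1/4 + 1/6 + 1/36]. *)

Set Implicit Arguments.
Unset Strict Implicit.
Unset Printing Implicit Defensive.

Import GRing.Theory Num.Theory.
Local Open Scope ring_scope.

Lemma rat_nat_neq0 (k : nat) : (0 < k)%N -> k%:R != 0 :> rat.
Proof. by rewrite pnatr_eq0 lt0n. Qed.

Lemma in_inv_multiples_compl (m n : nat) (v : rat) :
  in_inv_multiples n v -> in_inv_multiples n (m%:R / n%:R - v).
Proof.
case=> c ->; exists (m%:Z - c).
by rewrite intrB mulrBl.
Qed.

Lemma in_inv_multiples_dvdn (n a x : nat) : (0 < n)%N -> (0 < x)%N ->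
  in_inv_multiples n (a%:R / x%:R) -> (x %| a * n)%N.
Proof.
move=> n0 x0 [c].
move/eqP; rewrite eqr_div ?rat_nat_neq0 // => /eqP E.
have {}E : (a * n)%:Z = c * x%:Z.
  by apply: (@intr_inj rat); rewrite PoszM !intrM.
(* Divisibility over [int] unfolds to divisibility of absolute values, so the goal is convertible to
   one where [c], whose sign is unknown, may serve as the quotient. *)
by change (x%:Z %| (a * n)%:Z)%Z; apply/dvdzP; exists c.
Qed.

Lemma frac_sum3 (x y z : nat) (a : 'I_3 -> nat) :
  frac_sum a [tuple x; y; z] =
  (a (inord 0))%:R / x%:R + (a (inord 1))%:R / y%:R + (a (inord 2))%:R / z%:R.
Proof.
rewrite /frac_sum !big_ord_recl big_ord0 addr0 addrA.
by congr (_ / _ + _ / _ + _ / _); do 2 congr (_ _); apply: val_inj;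
  rewrite /= inordK.
Qed.

Lemma faithful_decomposition3 (n x y z r : nat) :
  (0 < n)%N -> (0 < x)%N -> (0 < y)%N -> (0 < z)%N ->
  r = 1 \/ r = 2 ->
  uniq [:: x; y; z] ->
  4 / n%:R = 1 / x%:R + 1 / y%:R + r%:R / z%:R :> rat ->
  ~~ (x %| n)%N -> ~~ (y %| n)%N -> ~~ (z %| r * n)%N ->
  (r = 2 -> ~ in_inv_multiples n (1 / x%:R + 1 / z%:R)) ->
  faithful_decomposition 4 n [tuple 1; 1; r] [tuple x; y; z].
Proof.
move=> n0 x0 y0 z0 r12 xyz E xn yn zn xzn.
have Nx : ~ in_inv_multiples n (1 / x%:R).
  by move/(in_inv_multiples_dvdn (a := 1) n0 x0); rewrite mul1n; apply/negP.
have Ny : ~ in_inv_multiples n (1 / y%:R).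
  by move/(in_inv_multiples_dvdn (a := 1) n0 y0); rewrite mul1n; apply/negP.
(* As [r] is 1 or 2, such a [c] divides [r], so [z] dividing [c * n] would divide [r * n]. *)
have Nz c : (0 < c <= r)%N -> ~ in_inv_multiples n (c%:R / z%:R).
  move=> cr /(in_inv_multiples_dvdn n0 z0) zc; case/negP: zn.
  by case: r12 cr zc => -> ; case: c => [|[|[|c]]] //; rewrite mul1n => _;
    apply: dvdn_mull.
split; first split.
- by case=> [[|[|[|i]]]] //= lti; rewrite /tnth /=; case: r12 => ->.
- by case=> [[|[|[|i]]]].
- by move=> i j eqij; apply: (tuple_uniqP _ xyz).
- rewrite /frac_sum !big_ord_recl big_ord0 addr0 addrA; exact: E.
move=> a le_a; rewrite frac_sum3.
have := le_a (inord 0); have := le_a (inord 1); have := le_a (inord 2).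
rewrite !(tnth_nth 0%N) !inordK //=.
move: (a _) (a _) (a _) => b d c cr d1 b1 Lv.
have Lw := in_inv_multiples_compl 4 Lv; rewrite E in Lw.
(* The pair (b, d) of coefficients of 1/x and 1/y runs through (0,0), (0,1), (1,0), (1,1). [Lv]
   concerns v and [Lw] concerns 4/n - v; in each case the one with the simpler sum is used. In
   particular 1/y + 1/z with r = 2 has complement 1/x + 1/z. *)
move: b d b1 d1 Lv Lw => [|[|//]] [|[|//]] _ _; rewrite ?mul0r ?add0r ?addr0.
- case: c cr => [|c] cr Lv _; first by right; rewrite mul0r.
  by case: (@Nz c.+1).
- case: (posnP c) => [-> /=|c0].
    by rewrite mul0r addr0 => /Ny [].
  case: (eqVneq c r) => [->|ncr] Lv Lw.
    by case: Nx; congr in_inv_multiples : Lw; ring.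
  have [c1 r2] : c = 1%N /\ r = 2%N by lia.
  by case: (xzn r2); rewrite c1 r2 in Lw; congr in_inv_multiples : Lw; ring.
- case: (posnP c) => [-> /=|c0].
    by rewrite mul0r addr0 => /Nx [].
  case: (eqVneq c r) => [->|ncr] Lv Lw.
    by case: Ny; congr in_inv_multiples : Lw; ring.
  have [c1 r2] : c = 1%N /\ r = 2%N by lia.
  by case: (xzn r2); rewrite c1 in Lv.
- case: (eqVneq c r) => [-> _ _|ncr Lv Lw]; first by left; rewrite E.
  case: (@Nz (r - c)%N); first lia.
  by rewrite natrB //; congr in_inv_multiples : Lw; ring.
Qed.

Lemma split_frac_3mod4 (n q : nat) : (0 < q)%N -> (n + 1 = 4 * q)%N ->
  4 / n%:R = 1 / q%:R + 1 / (n * q + 1)%:R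
             + 1 / (n * q * (n * q + 1))%:R :> rat.
Proof.
move=> q0 E.
have n0 : n%:R != 0 :> rat by apply: rat_nat_neq0; lia.
have q0' := rat_nat_neq0 q0.
have m0 := @rat_nat_neq0 (n * q + 1) ltac:(lia).
have {}E : n%:R = 4 * q%:R - 1 :> rat by rewrite -natrM -E natrD addrK.
rewrite !(natrM, natrD) in m0 *.
by move: n0 m0; rewrite E => n0 m0; field; rewrite q0' m0 n0.
Qed.

(** The numerator 3 is 4(q+1) - n. Keeping [v] abstract lets each residue of n(q+1) modulo 3 supply
    its own splitting. *)
Lemma split_frac_1mod4 (n q : nat) (v : rat) : n = (4 * q + 1)%N ->
  3 / (n * (q + 1))%:R = v -> 4 / n%:R = 1 / (q + 1)%:R + v :> rat.
Proof.
move=> E <-.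
have n0 := @rat_nat_neq0 n ltac:(lia).
have q0 := @rat_nat_neq0 (q + 1) ltac:(lia).
move: n0 q0; rewrite E !(natrM, natrD) => n0 q0.
by field; rewrite q0 n0.
Qed.

Lemma not_dvdn_gt (x n : nat) : (0 < n < x)%N -> ~~ (x %| n)%N.
Proof. by case/andP=> n0 nx; rewrite gtnNdvd. Qed.

(** Since n + 3 = 4(q+1), a divisor q+1 of n would divide 3, which leaves only q = 0 and q = 2. *)
Lemma not_dvdn_1mod4 (n q : nat) : (0 < q)%N -> q <> 2%N ->
  n = (4 * q + 1)%N -> ~~ (q + 1 %| n)%N.
Proof.
move=> q0 q2 ->; apply/negP => d.
have : (q + 1 %| 3)%N.
  rewrite -(dvdn_addr 3 d).
  by rewrite (_ : (4 * q + 1 + 3 = 4 * (q + 1))%N) ?dvdn_mull //; lia.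
by move/dvdnP=> [[|[|k]]]; nia.
Qed.

Lemma uniq3_ltn (x y z : nat) : (x < y < z)%N -> uniq [:: x; y; z].
Proof. by case/andP=> xy yz; rewrite /= !inE; lia. Qed.

Local Close Scope ring_scope.

Theorem theorem1p4 (n : nat) (hn : 5 <= n) (hirr : coprime 4 n) :
  exists x y z r : nat,
    (r = 1 \/ r = 2) /\
    faithful_decomposition 4 n [tuple 1; 1; r] [tuple x; y; z].
Proof.
have n_odd : odd n by rewrite -coprime2n -(@coprime_pexpl 2 2 n).
have n0 : 0 < n by lia.
have [q [E|E]] : exists q, n + 1 = 4 * q \/ n = 4 * q + 1.
  (* As n is odd, n + 1 is 4q or 4q + 2, and the quotient is q both times. *)
  by exists ((n + 1) %/ 4); lia.
  pose m := n * q.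
  have qm : q < m by rewrite /m -{1}[q]mul1n ltn_mul2r; lia.
  have nm : n < m by rewrite /m -{1}[n]muln1 ltn_mul2l; lia.
  have m1m : m + 1 < m * (m + 1) by rewrite -{1}[m + 1]mul1n ltn_mul2r; lia.
  exists q, (m + 1), (m * (m + 1)), 1; split; first by left.
  apply: (faithful_decomposition3 n0 _ _ _ (or_introl erefl)) => //; try lia.
  - by apply: uniq3_ltn; lia.
  - by apply: split_frac_3mod4 => //; lia.
  (* Here q divides n + 1 = 4q, so it cannot also divide n unless q = 1, which n >= 5 excludes. *)
  - apply/negP => d; have : q %| 1 by rewrite -(dvdn_addr 1 d) E dvdn_mull.
    by rewrite dvdn1; lia.
  - by apply: not_dvdn_gt; lia.
  - by apply: not_dvdn_gt; lia.
have q0 : 0 < q by lia.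
have [q2|/eqP q2] := eqVneq q 2.
  exists 4, 6, 36, 1; split; first by left.
  rewrite E q2.
  by apply: faithful_decomposition3 => //; left.
pose m := n * (q + 1).
have [t [M|[M|M]]] : exists t, m = 3 * t \/ m + 2 = 3 * t \/ m + 1 = 3 * t.
  by exists ((m + 2) %/ 3); lia.
(* For q = 1, m = 10 is not a multiple of 3. Hence q >= 3, so m >= 4n and t = m/3 exceeds n. *)
- have q1 : q <> 1 by move=> q1; move: M; rewrite /m E q1; lia.
  have q3 : 3 <= q by lia.
  exists (q + 1), (t + 1), (t * (t + 1)), 1; split; first by left.
  have m4n : 4 * n <= m by rewrite mulnC leq_mul2l; lia.
  have tn : n < t by lia.
  have tt1 : t + 1 < t * (t + 1) by rewrite -{1}[t + 1]mul1n ltn_mul2r; lia.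
  apply: (faithful_decomposition3 n0 _ _ _ (or_introl erefl)) => //; try lia.
  - by apply: uniq3_ltn; lia.
  - rewrite -addrA; apply: split_frac_1mod4 E _; rewrite -/m M.
    have t0 := @rat_nat_neq0 t ltac:(lia).
    have t1 := @rat_nat_neq0 (t + 1) ltac:(lia).
    rewrite !(natrM, natrD) in t1 *.
    by field; rewrite t0 t1.
  - exact: not_dvdn_1mod4.
  - by apply: not_dvdn_gt; lia.
  - by apply: not_dvdn_gt; lia.
- have m2n : 2 * n <= m by rewrite mulnC leq_mul2l; lia.
  have t3 : 3 <= t by lia.
  have mt : m < m * t by rewrite -{1}[m]muln1 ltn_mul2l; lia.
  (* For q = 1 the denominator t = 4 lies below n = 5, and that 4 does not divide 5 is checked
     directly. Otherwise m >= 3n and 3t = m + 2 force t > n. *)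
  have tn : t = 4 /\ n = 5 \/ n < t.
    case: (ltnP 1 q) => q1.
      have m3n : 3 * n <= m by rewrite mulnC leq_mul2l; lia.
      by right; lia.
    by left; move: M; rewrite /m E (_ : q = 1); lia.
  exists (q + 1), t, (m * t), 2; split; first by right.
  apply: (faithful_decomposition3 n0 _ _ _ (or_intror erefl)) => //; try lia.
  - by apply: uniq3_ltn; lia.
  - rewrite -addrA; apply: split_frac_1mod4 E _; rewrite -/m.
    have m0 := @rat_nat_neq0 m ltac:(lia).
    have t0 := @rat_nat_neq0 t ltac:(lia).
    have {}M : (m%:R = 3 * t%:R - 2 :> rat)%R by rewrite -natrM -M natrD addrK.
    rewrite natrM; move: m0; rewrite M => m0.
    by field; rewrite t0 m0.
  - exact: not_dvdn_1mod4.
  - by case: tn => [[-> ->] //|tn]; apply: not_dvdn_gt; lia.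
  - by apply: not_dvdn_gt; lia.
  (* The sum 1/(q+1) + 1/(mt) equals (nt+1)/(mt). If it were a multiple of 1/n, cancelling n would
     make (q+1)t divide nt + 1, hence t divide 1, against t >= 3. *)
  - move=> _ L; have : m * t %| (n * t + 1) * n.
      apply: in_inv_multiples_dvdn => //; first by lia.
      congr in_inv_multiples : L.
      have n0' := rat_nat_neq0 n0.
      have t0 := @rat_nat_neq0 t ltac:(lia).
      have q0' := @rat_nat_neq0 (q + 1) ltac:(lia).
      rewrite /m !(natrM, natrD) in q0' *.
      by field; rewrite t0 n0' q0'.
    rewrite /m -mulnA mulnC dvdn_pmul2r // => d.
    have : t %| 1.
      rewrite -(dvdn_addr 1 (dvdn_mull n (dvdnn t))).
      exact: dvdn_trans (dvdn_mull _ (dvdnn t)) d.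
    by rewrite dvdn1; lia.
(* Again q = 1 has the wrong residue, since m + 1 = 11, so q >= 3 and t > n. *)
- have q1 : q <> 1 by move=> q1; move: M; rewrite /m E q1; lia.
  have q3 : 3 <= q by lia.
  exists (q + 1), t, (m * t), 1; split; first by left.
  have m4n : 4 * n <= m by rewrite mulnC leq_mul2l; lia.
  have tn : n < t by lia.
  have tmt : t < m * t by rewrite -{1}[t]mul1n ltn_mul2r; lia.
  apply: (faithful_decomposition3 n0 _ _ _ (or_introl erefl)) => //; try lia.
  - by apply: uniq3_ltn; lia.
  - rewrite -addrA; apply: split_frac_1mod4 E _; rewrite -/m.
    have m0 := @rat_nat_neq0 m ltac:(lia).
    have t0 := @rat_nat_neq0 t ltac:(lia).
    have {}M : (m%:R = 3 * t%:R - 1 :> rat)%R by rewrite -natrM -M natrD addrK.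
    rewrite natrM; move: m0; rewrite M => m0.
    by field; rewrite t0 m0.
  - exact: not_dvdn_1mod4.
  - by apply: not_dvdn_gt; lia.
  - by apply: not_dvdn_gt; lia.
Qed.
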